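(* Let $S$ be a finite set, let $\mathcal{V}\le\mathcal{P}(S)$ have dimension $r$, and let $\mathscr{X}=(X_1,\dots,X_r)$ and $\mathscr{Y}=(Y_1,\dots,Y_r)$ be bases of $\mathcal{V}$. Let $M$ be the invertible $r\times r$ matrix over $\mathbb{F}_2$ with $z_{\mathscr{X}}(\vec b)=z_{\mathscr{Y}}(M\vec b)$ for all $\vec b\in\mathbb{F}_2^r$. Then $v_{\mathscr{X}}(\vec a)=v_{\mathscr{Y}}((M^T)^{-1}\vec a)$ for all $\vec a\in\mathbb{F}_2^r$.
   Context: $\mathcal{P}(S)$ is an $\mathbb{F}_2$-vector space under symmetric difference $\triangle$. For a basis $\mathscr{X}=(X_1,\dots,X_r)$ of $\mathcal{V}$ and $\vec a\in\mathbb{F}_2^r$ with support $I_{\vec a}=\{i:a_i=1\}$: $z_{\mathscr{X}}(\vec a)=\triangle_{i\in I_{\vec a}}X_i$ (equal to $\varnothing$ if $\vec a=\vec 0$), and $v_{\mathscr{X}}(\vec a)=\bigcap_{i\in I_{\vec a}}X_i\cap\bigcap_{i\notin I_{\vec a}}(S\setminus X_i)$ (the Venn region indexed by $\vec a$). *)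

(* Defs.v *)
From HB Require Import structures.
From mathcomp Require Import all_boot all_order all_algebra.
Set Implicit Arguments.
Unset Strict Implicit.
Unset Printing Implicit Defensive.
Import GRing.Theory.
Local Open Scope ring_scope.

Definition symdiff (S : finType) (A B : {set S}) : {set S} :=
  (A :\: B) :|: (B :\: A).

(* Alias of {set S} carrying the F_2-vector space structure whose addition is
   the symmetric difference. *)
Definition power (S : finType) : Type := {set S}.

Section PowerVectType.
Variable S : finType.
Implicit Types A B C : {set S}.

HB.instance Definition _ := Finite.copy (power S) {set S}.

Lemma in_symdiff A B x : (x \in symdiff A B) = (x \in A) (+) (x \in B).
Proof. by rewrite !inE; case: (x \in A); case: (x \in B). Qed.

Lemma symdiffA : associative (@symdiff S).
Proof. by move=> A B C; apply/setP=> x; rewrite !in_symdiff addbA. Qed.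

Lemma symdiffC : commutative (@symdiff S).
Proof. by move=> A B; apply/setP=> x; rewrite !in_symdiff addbC. Qed.

Lemma symdiff0 : left_id set0 (@symdiff S).
Proof. by move=> A; apply/setP=> x; rewrite in_symdiff inE. Qed.

Lemma symdiffN : left_inverse set0 id (@symdiff S).
Proof. by move=> A; apply/setP=> x; rewrite in_symdiff addbb inE. Qed.

HB.instance Definition _ := GRing.isZmodule.Build (power S)
  symdiffA symdiffC symdiff0 symdiffN.

Definition power_scale (c : 'F_2) (A : power S) : power S :=
  if c == 0 then 0 else A.

Lemma F2_cases (c : 'F_2) : c = 0 \/ c = 1.
Proof. by case: c => [[|[|//]] i]; [left | right]; apply: val_inj. Qed.

Lemma power_scaleA a b A :
  power_scale a (power_scale b A) = power_scale (a * b) A.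
Proof.
by rewrite /power_scale; case: (F2_cases a) => ->; case: (F2_cases b) => ->.
Qed.

Lemma power_scale1 : left_id 1 power_scale.
Proof. by []. Qed.

Lemma power_scaleDr : right_distributive power_scale +%R.
Proof.
move=> a A B; rewrite /power_scale; case: (F2_cases a) => -> //=.
by rewrite addr0.
Qed.

Lemma power_scaleDl A : {morph power_scale^~ A : a b / a + b}.
Proof.
move=> a b; rewrite /power_scale.
case: (F2_cases a) => ->; case: (F2_cases b) => ->; rewrite ?add0r ?addr0 //=.
by rewrite [RHS]symdiffN.
Qed.

HB.instance Definition _ := GRing.Zmodule_isLmodule.Build 'F_2 (power S)
  power_scaleA power_scale1 power_scaleDr power_scaleDl.

Definition power_row (A : power S) : 'rV['F_2]_#|S| :=
  \row_i (enum_val i \in (A : {set S}))%:R.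

Lemma power_row_linear : linear power_row.
Proof.
move=> a A B; apply/rowP=> i; rewrite !mxE.
have -> : (enum_val i \in (a *: A + B : {set S}))
        = (enum_val i \in (a *: A : {set S})) (+) (enum_val i \in (B : {set S})).
  exact: in_symdiff.
case: (F2_cases a) => ->; rewrite ?scale0r ?scale1r ?mul0r ?mul1r.
  by rewrite add0r (_ : (_ \in ((0 : power S) : {set S})) = false) // in_set0.
by case: (_ \in _); case: (_ \in _) => //=; apply: val_inj.
Qed.

Lemma power_row_bij : bijective power_row.
Proof.
exists (fun v : 'rV['F_2]_#|S| => [set x | v 0 (enum_rank x) == 1] : power S).
  move=> A; apply/setP=> x; rewrite inE mxE enum_rankK.
  by case: (_ \in _).
move=> v; apply/rowP=> i; rewrite mxE inE enum_valK.
by case: (F2_cases (v 0 i)) => ->.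
Qed.

Lemma power_vect_axiom : Vector.axiom #|S| (power S).
Proof. by exists power_row; [exact: power_row_linear | exact: power_row_bij]. Qed.

HB.instance Definition _ :=
  Lmodule_hasFinDim.Build 'F_2 (power S) power_vect_axiom.

End PowerVectType.

Section Venn.
Variables (S : finType) (r : nat).

Definition supp (a : 'cV['F_2]_r) : {set 'I_r} := [set i | a i 0 == 1].

Definition zsum (X : r.-tuple (power S)) (a : 'cV['F_2]_r) : {set S} :=
  \big[@symdiff S/set0]_(i in supp a) tnth X i.

(* When r = 0 both intersections are empty and the region is all of S. *)
Definition venn (X : r.-tuple (power S)) (a : 'cV['F_2]_r) : {set S} :=
  (\bigcap_(i in supp a) (tnth X i : {set S}))
    :&: (\bigcap_(i in ~: supp a) ~: (tnth X i : {set S})).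

End Venn.

(* Main.v *)
(** The point [x] lies in exactly one Venn region of [X], the one indexed by its
    incidence vector [w_X(x)], and it lies in [zsum X b] iff [b^T w_X(x) = 1].
    The hypothesis on [M] thus reads [b^T w_X(x) = b^T M^T w_Y(x)] for all [b],
    that is [w_X(x) = M^T w_Y(x)]. *)

Require Import Defs.
From HB Require Import structures.
From mathcomp Require Import all_boot all_order all_algebra.
Local Open Scope ring_scope.

Import GRing.Theory.

(** This is the vector $w_X(x)$, valued in ['F_2] so that matrices can act on it. *)
Definition incidence {S : finType} {r : nat} (X : r.-tuple (power S)) (x : S) :
    'cV['F_2]_r :=
  \col_i (x \in (tnth X i : {set S}))%:R.

Lemma in_venn (S : finType) (r : nat) (X : r.-tuple (power S))
    (a : 'cV['F_2]_r) (x : S) :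
  (x \in venn X a) = (incidence X x == a).
Proof.
rewrite /venn inE; apply/andP/eqP=> [[/bigcapP xin /bigcapP xout] | <-].
  apply/colP=> i; rewrite mxE.
  case: (F2_cases (a i 0)) => ai; rewrite ai.
    by have := xout i; rewrite !inE ai => /(_ isT) /negbTE ->.
  by have := xin i; rewrite !inE ai => /(_ isT) ->.
by split; apply/bigcapP=> i; rewrite !inE mxE; case: (_ \in _).
Qed.

(** For fixed [x], the membership indicator [chi] is additive from symmetric difference to ['F_2],
    so it passes through the iterated symmetric difference. *)
Lemma in_zsum (S : finType) (r : nat) (X : r.-tuple (power S))
    (b : 'cV['F_2]_r) (x : S) :
  (x \in zsum X b)%:R = (b^T *m incidence X x) 0 0.
Proof.
pose chi (A : {set S}) : 'F_2 := (x \in A)%:R.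
have chiD : {morph chi : A B / symdiff A B >-> A + B}.
  move=> A B; rewrite /chi in_symdiff.
  by case: (x \in A); case: (x \in B); apply: val_inj.
have chi0 : chi set0 = 0 by rewrite /chi inE.
(* Extending the sum from [supp b] to all indices turns the support condition into the coefficient
   [b i 0]. *)
rewrite -/(chi _) /zsum (big_morph chi chiD chi0) big_mkcond mxE.
apply: eq_bigr => i _; rewrite !mxE inE.
by case: (F2_cases (b i 0)) => ->; rewrite ?mul0r ?mul1r.
Qed.

Lemma incidence_change_basis (S : finType) (r : nat) (X Y : r.-tuple (power S))
    (M : 'M['F_2]_r) (x : S) :
  (forall b : 'cV['F_2]_r, zsum X b = zsum Y (M *m b)) ->
  incidence X x = M^T *m incidence Y x.
Proof.
move=> zM; apply/colP=> i.
(* Pairing with the unit vector $e_i$ reads off coordinate $i$; on the [Y] side, $(M e_i)^T w_Y(x) =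
   e_i^T (M^T w_Y(x))$. *)
have := in_zsum _ _ X (delta_mx i 0) x.
rewrite zM in_zsum trmx_mul trmx_delta -mulmxA -!rowE.
by rewrite [in LHS]mxE [in RHS]mxE => ->.
Qed.

Theorem theorem3p16 (S : finType) (r : nat) (V : {vspace power S})
    (dimV : \dim V = r)
    (X Y : r.-tuple (power S)) (basisX : basis_of V X) (basisY : basis_of V Y)
    (M : 'M['F_2]_r) (unitM : M \in unitmx)
    (zM : forall b : 'cV['F_2]_r, zsum X b = zsum Y (M *m b)) :
  forall a : 'cV['F_2]_r, venn X a = venn Y (invmx (M^T) *m a).
Proof.
have unitMT : M^T \in unitmx by rewrite unitmx_tr.
move=> a; apply/setP=> x.
rewrite !in_venn (incidence_change_basis _ _ _ _ _ x zM).
by apply/eqP/eqP=> [<- | ->]; rewrite ?mulKmx ?mulKVmx.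
Qed.
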